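(* Let $K$ be a field of prime characteristic $p$ and let $L/K$ be a finite field extension. Then: 1. The subalgebra of $E(L/K)$ which is generated by the automorphism group $G(L/K)$ and the algebra of differential operators $\mathcal{D}(L/K)$ is the skew group algebra $$\mathcal{D}(L/K)\rtimes G(L/K)=\bigoplus_{g\in G(L/K)}\mathcal{D}(L/K)g$$ where the multiplication is given by the rule: for all elements $\delta,\delta'\in\mathcal{D}(L/K)$ and $g,g'\in G(L/K)$, $$\delta g\cdot\delta'g'=\delta\,g\delta'g^{-1}\cdot gg',\quad\text{where } g\delta'g^{-1}\in\mathcal{D}(L/K).$$ 2. $\mathcal{D}(L/K)\rtimes G(L/K)=E\big(L/L^{G(L/K)}_{dif}\big)$, and this is a central simple finite dimensional algebra over the field $L^{G(L/K)}_{dif}$, where $L^{G(L/K)}_{dif}:=L^{G(L/K)}\cap L_{dif}$. 3. $C_{E(L/K)}(\mathcal{D}(L/K)\rtimes G(L/K))=L^{G(L/K)}_{dif}$ and $C_{E(L/K)}\big(L^{G(L/K)}_{dif}\big)=\mathcal{D}(L/K)\rtimes G(L/K)$.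
   Context: For a finite field extension $L/K$: $E(L/K)=\mathrm{End}_K(L)$; $L$ is viewed as a subfield of $E(L/K)$ via multiplication operators. For an intermediate field $M$, $E(L/M)=\mathrm{End}_M(L)\subseteq E(L/K)$. $G(L/K)=\mathrm{Aut}_{K\text{-alg}}(L)\subseteq E(L/K)$ and $L^{G(L/K)}$ is its fixed field. $\mathcal{D}(L/K)=\bigcup_{i\ge0}\mathcal{D}_i\subseteq E(L/K)$ is the algebra of $K$-linear differential operators on $L$, where $\mathcal{D}_0=L$ and $\mathcal{D}_i=\{\delta\in E(L/K)\mid\delta l-l\delta\in\mathcal{D}_{i-1}\text{ for all }l\in L\}$. $L_{dif}=\{l\in L\mid l\delta=\delta l\text{ for all }\delta\in\mathcal{D}(L/K)\}$. $C_{E(L/K)}(S)$ is the centralizer of $S$ in $E(L/K)$. The directness of the sum in part 1 (as a sum of left $\mathcal{D}(L/K)$-submodules of $E(L/K)$, each $\mathcal{D}(L/K)g$ being free of rank one) is part of the assertion. *)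

(* Defs.v *)
From HB Require Import structures.
From mathcomp Require Export all_boot all_order all_algebra all_field.
From mathcomp Require Export boolp classical_sets.

Set Implicit Arguments.
Unset Strict Implicit.
Unset Printing Implicit Defensive.

Import GRing.Theory.
Local Open Scope classical_set_scope.
Local Open Scope ring_scope.

(* E(L/K) is the type 'End(L) of K-linear endomorphisms of L.  Its product is
   written as composition \o, because the ring structure of FalgLfun on 'End(L)
   multiplies in the opposite order.  L embeds in 'End(L) through amull. *)

Section Endomorphisms.

Variables (K : fieldType) (L : fieldExtType K).
Implicit Types (f g h d : 'End(L)) (l : L) (A D G S : set 'End(L)).

Definition End_over (M : {subfield L}) : set 'End(L) :=
  [set f | forall m x, m \in M -> f (m * x) = m * f x].

Definition centralizer S : set 'End(L) :=
  [set f | forall h, S h -> (f \o h = h \o f)%VF].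

Definition is_subalgebra A : Prop :=
  [/\ A \1%VF,
      forall f h, A f -> A h -> A (f + h),
      forall (a : K) f, A f -> A (a *: f)
    & forall f h, A f -> A h -> A (f \o h)%VF].

Definition generated_subalgebra S : set 'End(L) := smallest is_subalgebra S.

Definition is_ideal A I : Prop :=
  [/\ I `<=` A,
      I 0,
      forall f h, I f -> I h -> I (f + h)
    & forall a f, A a -> I f -> I (a \o f)%VF /\ I (f \o a)%VF].

Definition is_simple A : Prop :=
  A <> [set 0] /\ forall I, is_ideal A I -> I = [set 0] \/ I = A.

Definition finite_dim_over (M : {subfield L}) A : Prop :=
  exists e : seq 'End(L),
    A = [set f | exists c : nat -> L, (forall i, c i \in M) /\
                 f = \sum_(i < size e) (amull (c i) \o e`_i)%VF].

(* The second clause says both that A is an M-algebra, i.e. M lies in its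
   center, and that it is central over M. *)
Definition central_simple_fin_dim (M : {subfield L}) A : Prop :=
  [/\ is_subalgebra A,
      A `&` centralizer A = [set amull m | m in [set` M]],
      is_simple A
    & finite_dim_over M A].

(* For G possibly infinite a priori, \sum_(g in G) M g is the set of finite
   sums of elements x g of M g, for g ranging over distinct elements of G. *)
Definition family_on G (M : 'End(L) -> set 'End(L))
    (s : seq 'End(L)) (x : 'End(L) -> 'End(L)) : Prop :=
  uniq s /\ forall g, g \in s -> G g /\ M g (x g).

Definition family_sum G (M : 'End(L) -> set 'End(L)) : set 'End(L) :=
  [set f | exists s x, family_on G M s x /\ f = \sum_(g <- s) x g].

Definition family_direct G (M : 'End(L) -> set 'End(L)) : Prop :=
  forall s x, family_on G M s x -> \sum_(g <- s) x g = 0 ->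
  forall g, g \in s -> x g = 0.

Definition left_multiples D g : set 'End(L) := [set (d \o g)%VF | d in D].

Definition free_generator D g : Prop :=
  forall d, D d -> (d \o g)%VF = 0 -> d = 0.

End Endomorphisms.

Section FieldExtension.

Variables (K : fieldType) (L : fieldExtType K).

Definition AutG : set 'End(L) := [set g | kAut 1 {:L} g].

Fixpoint Diff_order (i : nat) : set 'End(L) :=
  if i is j.+1 then
    [set d | forall l : L,
       Diff_order j ((d \o amull l)%VF - (amull l \o d)%VF)]
  else range (@amull K L).

Definition Diff : set 'End(L) := \bigcup_i Diff_order i.

Definition L_dif : set L :=
  [set l | forall d, Diff d -> (amull l \o d = d \o amull l)%VF].

Definition L_fix : set L := [set l | forall g, AutG g -> g l = l].

Definition L_fix_dif : set L := L_fix `&` L_dif.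

Definition Diff_Aut : set 'End(L) := family_sum AutG (left_multiples Diff).

End FieldExtension.

Arguments AutG {K} L.
Arguments Diff {K} L.
Arguments L_dif {K} L.
Arguments L_fix {K} L.
Arguments L_fix_dif {K} L.
Arguments Diff_Aut {K} L.

(* Main.v *)
(* A subalgebra A of End_K(L) containing L has a left L-basis (a_i) dual to some
   points x_i of L, so a = sum_i a(x_i) a_i for all a in A.  Applied to a a_i this
   gives a a_i = a(1) a_i, hence (with a replaced by a y) every a_i(x) commutes
   with A.  So any f commuting with the field M of scalars that commute with A is
   sum_i f(x_i) a_i, and A = End_M(L) (Jacobson--Bourbaki).  No structure theory of
   L/K is needed: D(L/K) G(L/K) is such a subalgebra, with M the fixed field of
   G(L/K) in L_dif.  Directness of the sum is Artin's argument for the independence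
   of automorphisms, by induction on the order of one of the coefficients. *)
Require Import Defs.

Set Implicit Arguments.
Unset Strict Implicit.
Unset Printing Implicit Defensive.

Import GRing.Theory.
Local Open Scope classical_set_scope.
Local Open Scope ring_scope.

(** * Dual bases and the Jacobson-Bourbaki theorem for subalgebras containing L *)

Section JacobsonBourbaki.

Variables (K : fieldType) (L : fieldExtType K).
Implicit Types (f g h d : 'End(L)) (l m x y : L) (A : set 'End(L)).

Lemma amullE l x : amull l x = l * x.
Proof. by rewrite lfunE. Qed.

Lemma comp_amull l m : (amull l \o amull m)%VF = amull (l * m) :> 'End(L).
Proof. by apply/lfunP => x; rewrite comp_lfunE !amullE mulrA. Qed.

Lemma comp_lfun_suml (I : Type) (r : seq I) (P : pred I) (F : I -> 'End(L)) h :
  ((\sum_(i <- r | P i) F i) \o h = \sum_(i <- r | P i) (F i \o h))%VF.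
Proof.
by apply/lfunP => x; rewrite comp_lfunE !sum_lfunE; apply: eq_bigr => i _;
  rewrite comp_lfunE.
Qed.

Lemma comp_lfun_sumr (I : Type) (r : seq I) (P : pred I) (F : I -> 'End(L)) h :
  (h \o (\sum_(i <- r | P i) F i) = \sum_(i <- r | P i) (h \o F i))%VF.
Proof.
apply/lfunP => x; rewrite comp_lfunE !sum_lfunE raddf_sum.
by apply: eq_bigr => i _; rewrite comp_lfunE.
Qed.

(** A subspace contained in [A] of maximal dimension must be all of [A]: adjoining the line through
    a further vector of [A] stays inside [A]. This makes dimension and bases available for sets
    given by a predicate in [Prop]. *)
Lemma set_of_vspace (W : vectType K) (A : set W) :
    A 0 -> (forall u v, A u -> A v -> A (u + v)) ->
    (forall (a : K) u, A u -> A (a *: u)) ->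
  exists V : {vspace W}, [set` V] = A.
Proof.
move=> A0 AD AZ.
pose P n := `[< exists V : {vspace W}, \dim V = n /\ [set` V] `<=` A >].
have Pex : exists n, P n.
  exists 0%N; apply/asboolP; exists 0%VS; split; first exact: dimv0.
  by move=> u /=; rewrite memv0 => /eqP ->.
have Pub n : P n -> (n <= \dim {:W})%N.
  by move=> /asboolP [V [<- _]]; apply/dimvS/subvf.
case: (ex_maxnP Pex Pub) => n /asboolP [V [dimV VA]] maxn.
exists V; apply/seteqP; split=> // u Au /=.
have VuA : [set` (V + <[u]>)%VS] `<=` A.
  move=> _ /= /memv_addP [v Vv [_ /vlineP [a ->] ->]].
  by apply: AD; [apply: VA | apply: AZ].
have /maxn : P (\dim (V + <[u]>)) by apply/asboolP; exists (V + <[u]>)%VS.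
rewrite -dimV => le_dim.
have /eqP -> : (V == V + <[u]>)%VS by rewrite eqEdim addvSl.
by apply: (subvP (addvSr _ _)); apply: memv_line.
Qed.

(* Gaussian elimination; the q.2 form a left L-basis of V. *)
Lemma dual_system (V : {vspace 'End(L)}) :
    (forall l v, v \in V -> (amull l \o v)%VF \in V) ->
  exists s : seq (L * 'End(L)),
    [/\ uniq s, forall q, q \in s -> q.2 \in V,
        forall q r, q \in s -> r \in s -> r.2 q.1 = (q == r)%:R
      & forall v, v \in V -> v = \sum_(q <- s) (amull (v q.1) \o q.2)%VF].
Proof.
elim: {V}(\dim V) {-2}V (leqnn (\dim V)) => [|n IHn] V.
  rewrite leqn0 dimv_eq0 => /eqP -> _; exists [::]; split=> // v.
  by rewrite memv0 big_nil => /eqP.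
move=> dimV VL.
have [->|] := eqVneq V 0%VS.
  by exists [::]; split=> // v; rewrite memv0 big_nil => /eqP.
rewrite -vpick0; set b := vpick V => b_neq0.
have Vb : b \in V by apply: memv_pick.
have [y by_neq0] : exists y, b y != 0.
  apply/not_existsP => b0; case/eqP: b_neq0; apply/lfunP => y.
  by rewrite lfunE; apply/eqP; have /negP := b0 y; rewrite negbK.
(* The induction runs on the operators of [V] that vanish at [y]. They are stable under left
   multiplication by L, and [b] lies outside, so the dimension drops. *)
have [V' V'E] : exists V' : {vspace 'End(L)},
    [set` V'] = [set v : 'End(L) | v \in V /\ v y = 0].
  apply: set_of_vspace; first by split; rewrite ?mem0v ?lfunE.
    by move=> u v [Vu uy] [Vv vy]; split; rewrite ?memvD // add_lfunE uy vy addr0.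
  by move=> a u [Vu uy]; split; rewrite ?memvZ // scale_lfunE uy scaler0.
have V'P v : v \in V' <-> v \in V /\ v y = 0.
  by have : [set` V'] v <-> [set v | v \in V /\ v y = 0] v by rewrite V'E.
have sV'V : (V' <= V)%VS by apply/subvP => v /V'P [].
have dimV' : (\dim V' <= n)%N.
  rewrite -ltnS; apply: leq_trans dimV.
  rewrite (ltn_leqif (dimv_leqif_sup sV'V)); apply/subvPn; exists b => //.
  by apply/negP => /V'P [_ /eqP]; apply/negP.
have [l v /V'P [Vv vy]|s [s_uniq sV' s_dual s_gen]] := IHn V' dimV'.
  by apply/V'P; split; [apply: VL | rewrite comp_lfunE amullE vy mulr0].
(* [c] scales [b] to the value 1 at [y]. Subtracting its expansion in the old system makes [a]
   vanish at the old points without changing the value at [y], where every old [q.2] is 0. *)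
pose c := (amull ((b y)^-1)%R \o b)%VF.
pose a := c - \sum_(q <- s) (amull (c q.1) \o q.2)%VF.
have cy : c y = 1 by rewrite comp_lfunE amullE mulVf.
have sV q : q \in s -> q.2 \in V by move=> /sV' /V'P [].
have s_y q : q \in s -> q.2 y = 0 by move=> /sV' /V'P [].
have sumE v x : (\sum_(q <- s) (amull (v q.1) \o q.2)%VF : 'End(L)) x
    = \sum_(q <- s) v q.1 * q.2 x.
  by rewrite sum_lfunE; apply: eq_bigr => q _; rewrite comp_lfunE amullE.
have Va : a \in V.
  rewrite memvB ?VL // big_seq memv_suml // => q sq.
  by apply: VL; apply: sV.
have ay : a y = 1.
  rewrite add_lfunE opp_lfunE sumE cy big_seq big1 ?subr0 // => q sq.
  by rewrite s_y ?mulr0.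
have as_ q : q \in s -> a q.1 = 0.
  move=> sq; rewrite add_lfunE opp_lfunE sumE (bigD1_seq q) //= s_dual // eqxx.
  rewrite mulr1 big_seq_cond big1 ?addr0 ?subrr // => r /andP [sr /negbTE rq].
  by rewrite s_dual // eq_sym rq mulr0.
have ya_notin : (y, a) \notin s.
  by apply/negP => /s_y /= /eqP; rewrite ay oner_eq0.
exists ((y, a) :: s); split.
- by rewrite /= ya_notin.
- by move=> q; rewrite inE => /predU1P [-> //|/sV].
- move=> q r; rewrite !inE => /predU1P [->|sq] /predU1P [->|sr] /=.
  + by rewrite ay eqxx.
  + by rewrite s_y //; case: eqP => // e; rewrite e sr in ya_notin.
  + by rewrite as_ //; case: eqP => // e; rewrite -e sq in ya_notin.
  + exact: s_dual.
(* [v - v(y) a] vanishes at [y], so it expands in the old system; its coefficients are those of [v]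
   because [a] is 0 at the old points. *)
- move=> v Vv; rewrite big_cons /=; apply/eqP; rewrite addrC -subr_eq; apply/eqP.
  rewrite {1}[v - _]s_gen; last first.
    apply/V'P; split; first by rewrite memvB ?VL.
    by rewrite add_lfunE opp_lfunE comp_lfunE amullE ay mulr1 subrr.
  apply: eq_big_seq => q sq.
  by rewrite add_lfunE opp_lfunE comp_lfunE amullE as_ // mulr0 subr0.
Qed.

(** The list is a dual system of [A]: points [q.1], operators [q.2]. The last clause expands every
    [f] linear over the scalars commuting with [A], not just members of [A]; this is what yields the
    double centralizer property. *)
Lemma Jacobson_Bourbaki A :
    is_subalgebra A -> (forall l, A (amull l)) ->
  exists s : seq (L * 'End(L)),
    [/\ forall q, q \in s -> A q.2,
        forall q x, q \in s -> centralizer A (amull (q.2 x))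
      & forall f, (forall m, centralizer A (amull m) ->
                    (f \o amull m = amull m \o f)%VF) ->
                  f = \sum_(q <- s) (amull (f q.1) \o q.2)%VF].
Proof.
case=> A1 AD AZ AM AL.
have A0 : A 0 by rewrite -(scale0r \1%VF); apply: AZ.
have [V VA] := set_of_vspace A0 AD AZ.
have VP v : v \in V <-> A v by rewrite -VA.
have [l v /VP Av|s [s_uniq sV s_dual s_gen]] := @dual_system V.
  by apply/VP; apply: AM.
have sA q : q \in s -> A q.2 by move=> /sV /VP.
(* In the expansion of [a \o q.2] the coefficient at [r] is [a (q.2 r.1)], which is [a 1] for
   [r = q] and [a 0 = 0] otherwise. *)
have s_abs a q : A a -> q \in s -> (a \o q.2 = amull (a 1) \o q.2)%VF.
  move=> Aa sq; rewrite [LHS]s_gen; last by apply/VP/AM => //; apply: sA.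
  rewrite (bigD1_seq q) //= comp_lfunE s_dual // eqxx.
  rewrite big_seq_cond big1 ?addr0 // => r /andP [sr /negbTE rq].
  by rewrite comp_lfunE s_dual // rq /= linear0 linear0 comp_lfun0l.
(* Absorption for [a \o amull y] reads [a (y * q.2 x) = a y * q.2 x]: multiplication by [q.2 x]
   commutes with [a]. *)
have s_cent q x : q \in s -> centralizer A (amull (q.2 x)).
  move=> sq a Aa; apply/lfunP => y; rewrite !comp_lfunE !amullE.
  have /lfunP/(_ x) := s_abs (a \o amull y)%VF q (AM _ _ Aa (AL y)) sq.
  by rewrite !comp_lfunE !amullE mulr1 [y * _]mulrC [a y * _]mulrC.
exists s; split=> // f f_lin; apply/lfunP => x.
(* The identity expands as [x = \sum q.1 * q.2 x]; applying [f], the factors [q.2 x] come out as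
   scalars. *)
have /lfunP/(_ x) := s_gen _ ((VP _).2 A1).
rewrite !sum_lfunE lfunE /= => {1}->; rewrite linear_sum; apply: eq_big_seq => q sq.
have /lfunP/(_ q.1) := f_lin _ (s_cent q x sq).
by rewrite !comp_lfunE !amullE lfunE /= [q.1 * _]mulrC => ->; rewrite mulrC.
Qed.

Lemma is_subalgebra_sum A (I : Type) (r : seq I) (P : pred I) (F : I -> 'End(L)) :
  is_subalgebra A -> (forall i, P i -> A (F i)) -> A (\sum_(i <- r | P i) F i).
Proof.
move=> [A1 AD AZ _] AF; apply: big_ind => //.
by rewrite -(scale0r \1%VF); apply: AZ.
Qed.

(** Let [f] be in the ideal with [f y != 0]. Since the values of [q.2] are scalars for [f], the
    operator [f \o amull y \o q.2] equals [f y] times [q.2]. Dividing by [f y] puts each [q.2] in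
    the ideal, and these span [A] over L. *)
Lemma Jacobson_Bourbaki_simple A :
  is_subalgebra A -> (forall l, A (amull l)) -> is_simple A.
Proof.
move=> Asub AL; have [s [sA s_cent s_gen]] := Jacobson_Bourbaki Asub AL.
have [A1 AD AZ AM] := Asub; split=> [A0|I [sIA I0 ID IM]].
  have : [set 0 : 'End(L)] \1%VF by rewrite -A0.
  by move/lfunP/(_ 1)/eqP; rewrite id_lfunE lfunE oner_eq0.
have [I_0|] := pselect (I `<=` [set 0]).
  by left; apply/seteqP; split=> // _ ->.
move/existsNP => [f /not_implyP [If f_neq0]]; right; apply/seteqP; split=> // a Aa.
have [y fy] : exists y, f y != 0.
  apply/not_existsP => f0; apply: f_neq0; apply/lfunP => y.
  by rewrite lfunE; apply/eqP; have /negP := f0 y; rewrite negbK.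
rewrite [a]s_gen => [|m m_cent]; last by rewrite -m_cent.
rewrite big_seq; apply: (big_ind I) => // q sq.
have -> : (amull (a q.1) \o q.2 =
    amull ((a q.1 / f y)%R) \o (f \o (amull y \o q.2)))%VF.
  apply/lfunP => x; rewrite !comp_lfunE !amullE.
  have /lfunP/(_ y) := s_cent q x sq f (sIA f If).
  by rewrite !comp_lfunE !amullE [y * _]mulrC => <-; rewrite mulrCA mulfVK // mulrC.
have Aq : A (amull y \o q.2)%VF by apply: AM => //; apply: sA.
by have [_ Ifq] := IM _ f Aq If; have [] := IM _ _ (AL (a q.1 / f y)) Ifq.
Qed.

(** A K-basis of [A] already spans it over the larger field [M]. *)
Lemma finite_dim_over_subalgebra (M : {subfield L}) A :
  is_subalgebra A -> (forall m, m \in M -> A (amull m)) -> finite_dim_over M A.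
Proof.
move=> Asub AL; have [A1 AD AZ AM] := Asub.
have A0 : A 0 by rewrite -(scale0r \1%VF); apply: AZ.
have [V VA] := set_of_vspace A0 AD AZ.
exists (vbasis V); apply/seteqP; split=> [f|_ [c [Mc ->]]].
  rewrite -VA => /= /coord_vbasis Vf.
  (* The K-coordinates are embedded in L by [%:A], with value 0 beyond the basis because [c] is
     indexed by [nat]. *)
  pose c i := if insub i is Some j then (coord (vbasis V) j f)%:A else 0 : L.
  exists c; split=> [i|].
    by rewrite /c; case: insubP => [j _ _|_]; rewrite ?mem0v ?memvZ ?mem1v.
  rewrite size_tuple {1}Vf; apply: eq_bigr => i _; rewrite /c valK.
  by apply/lfunP => x; rewrite comp_lfunE amullE scale_lfunE mulr_algl.
apply: is_subalgebra_sum => // i _; apply: AM; first exact: AL.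
by rewrite -VA /=; apply/vbasis_mem/mem_nth.
Qed.

End JacobsonBourbaki.

Section SkewGroupAlgebra.

Variables (K : fieldType) (L : fieldExtType K).
Implicit Types (f g h d : 'End(L)) (l m x y : L) (A : set 'End(L)).

(** * The order filtration on differential operators *)

Local Notation Diff_order := (@Diff_order K L).

(** As L is commutative, the bracket with an element of L is left L-linear in the operator, so each
    step of the filtration inherits closure from the previous one. *)
Lemma Diff_order_submod i :
  [/\ Diff_order i 0,
      forall d h, Diff_order i d -> Diff_order i h -> Diff_order i (d + h)
    & forall l d, Diff_order i d -> Diff_order i (amull l \o d)%VF].
Proof.
elim: i => [|i [IH0 IHD IHl]] /=.
  split; first by exists 0; rewrite ?linear0.
    by move=> _ _ [l _ <-] [m _ <-]; exists (l + m); rewrite ?linearD.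
  by move=> l _ [m _ <-]; exists (l * m); rewrite ?comp_amull.
split=> [l|d h Dd Dh l|l d Dd m].
- by rewrite comp_lfun0l comp_lfun0r subrr.
- rewrite comp_lfunDl comp_lfunDr opprD addrACA; exact: IHD.
- rewrite comp_lfunA comp_amull mulrC -comp_amull -!comp_lfunA.
  by rewrite -comp_lfunNr -comp_lfunDr; apply: IHl.
Qed.

Lemma Diff_orderS i d : Diff_order i d -> Diff_order i.+1 d.
Proof.
elim: i d => [|i IH] d; last by move=> Dd l; apply/IH/Dd.
move=> [m _ <-] l; exists 0 => //.
by rewrite linear0 !comp_amull mulrC subrr.
Qed.

Lemma Diff_orderW i j d : (i <= j)%N -> Diff_order i d -> Diff_order j d.
Proof.
move=> /subnK <-; elim: (j - i)%N => [//|k IH] Dd; rewrite addSn.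
exact/Diff_orderS/IH.
Qed.

(** Double induction through the Leibniz rule [[d h, l] = d [h, l] + [d, l] h]; each summand has
    total order one less. *)
Lemma Diff_order_comp i j d h :
  Diff_order i d -> Diff_order j h -> Diff_order (i + j) (d \o h)%VF.
Proof.
elim: i j d h => [|i IHi] j d h.
  by case=> l _ <-; have [_ _] := Diff_order_submod j; apply.
elim: j h => [|j IHj] h Dd Dh.
  rewrite addn0; case: Dh => m _ <- l.
  have Dm : Diff_order 0 (amull m) by exists m.
  have := IHi 0%N _ _ (Dd l) Dm; rewrite addn0 comp_lfunDl comp_lfunNl.
  by rewrite -!comp_lfunA !comp_amull mulrC.
move=> l.
have -> : (((d \o h) \o amull l) - (amull l \o (d \o h)) =
    (d \o ((h \o amull l) - (amull l \o h))) +
    (((d \o amull l) - (amull l \o d)) \o h))%VF.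
  rewrite comp_lfunDr comp_lfunDl comp_lfunNr comp_lfunNl !comp_lfunA.
  by rewrite addrA subrK.
have [_ add _] := Diff_order_submod (i + j.+1).
by apply: add; [rewrite addnS -addSn; apply: IHj | apply: IHi].
Qed.

Lemma Diff_amull l : Diff L (amull l).
Proof. by exists 0%N => //; exists l. Qed.

Lemma Diff_subalgebra : is_subalgebra (Diff L).
Proof.
have Dcomp f h : Diff L f -> Diff L h -> Diff L (f \o h)%VF.
  by move=> [i _ Df] [j _ Dh]; exists (i + j)%N => //; apply: Diff_order_comp.
split=> //.
- by rewrite -amull1; apply: Diff_amull.
- move=> f h [i _ Df] [j _ Dh]; exists (maxn i j) => //.
  have [_ add _] := Diff_order_submod (maxn i j).
  by apply: add; [apply: Diff_orderW Df; apply: leq_maxl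
                 |apply: Diff_orderW Dh; apply: leq_maxr].
- move=> a f Df; have -> : a *: f = (amull a%:A \o f)%VF.
    by apply/lfunP => x; rewrite comp_lfunE amullE scale_lfunE mulr_algl.
  by apply: Dcomp => //; apply: Diff_amull.
Qed.

(** * Automorphisms and their conjugation action on differential operators *)

Lemma AutG_kHom g : AutG L g <-> kHom 1 {:L} g.
Proof. by rewrite /AutG /= kAutfE. Qed.

Lemma AutG_lker0 g : AutG L g -> lker g == 0%VS.
Proof. by move=> /AutG_kHom /kAutf_lker0. Qed.

Lemma AutG_comp_amull g l :
  AutG L g -> (g \o amull l = amull (g l) \o g)%VF.
Proof.
move=> /AutG_kHom /kHom_monoid_morphism [_ gM].
by apply/lfunP => x; rewrite !comp_lfunE !amullE gM.
Qed.

Lemma AutG1 g : AutG L g -> g 1 = 1.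
Proof. by move=> /AutG_kHom /kHom_monoid_morphism []. Qed.

Lemma AutG_id : AutG L \1%VF.
Proof. exact/AutG_kHom/kHom1. Qed.

Lemma AutG_comp g h : AutG L g -> AutG L h -> AutG L (g \o h)%VF.
Proof. by move=> /AutG_kHom Gg /AutG_kHom Gh; apply/AutG_kHom/comp_kHom. Qed.

Lemma AutG_inv g : AutG L g -> AutG L g^-1%VF.
Proof. by move=> /AutG_kHom Gg; apply/AutG_kHom/inv_kHomf. Qed.

(** Conjugation preserves the order, by induction: [[g d g^-1, g l] = g [d, l] g^-1], used with
    [g^-1 l] in place of [l]. *)
Lemma AutG_conj_Diff g d : AutG L g -> Diff L d -> Diff L (g \o d \o g^-1)%VF.
Proof.
move=> Gg [i _ Dd]; exists i => //; elim: i d Dd => [|i IH] d.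
  case=> l _ <-; exists (g l) => //.
  by rewrite AutG_comp_amull // lker0_compfK // AutG_lker0.
move=> Dd l; have := IH _ (Dd (g^-1%VF l)).
rewrite comp_lfunDr comp_lfunDl comp_lfunNr comp_lfunNl !comp_lfunA.
rewrite (AutG_comp_amull _ Gg) lker0_lfunVK ?AutG_lker0 // -!comp_lfunA.
by rewrite -AutG_comp_amull //; apply: AutG_inv.
Qed.

(** * Independence of automorphisms over the differential operators *)

Lemma Diff_eigen d b c :
  Diff L d -> (d \o amull b = amull c \o d)%VF -> b != c -> d = 0.
Proof.
case=> i _ Dd d_eig bc; elim: i Dd => [|i IH] Dd; last first.
  have [_ _ Dl] := Diff_order_submod i.
  (* The hypothesis gives [[d, b] = (c - b) d], so [d] is [(c - b)^-1] times a bracket and its order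
     drops by one. At order 0, [d] is multiplication by some [m] with [m * b = c * m], which forces
     [m = 0]. *)
  apply: IH; have := Dl (c - b)^-1 _ (Dd b).
  rewrite d_eig -comp_lfunNl -linearN -comp_lfunDl -linearD comp_lfunA.
  by rewrite comp_amull mulVf ?amull1 ?comp_lfun1l // subr_eq0 eq_sym.
case: Dd d_eig => m _ <-; rewrite !comp_amull => /amull_inj /eqP.
rewrite mulrC -subr_eq0 -mulrBl mulf_eq0 subr_eq0 (negbTE bc) => /eqP ->.
by rewrite linear0.
Qed.

(** Choose [l] where [h] and [g] differ and cancel [h] on the right: [d] then intertwines [h l] with
    the different element [g l]. *)
Lemma Diff_Aut_eigen d g h :
    AutG L g -> AutG L h -> Diff L d -> h != g ->
    (forall l, (d \o h) \o amull l = amull (g l) \o (d \o h))%VF ->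
  d = 0.
Proof.
move=> Gg Gh Dd hg d_eig; have [l hgl] : exists l, h l != g l.
  apply/not_existsP => hgE; case/eqP: hg; apply/lfunP => l.
  by apply/eqP; have /negP := hgE l; rewrite negbK.
apply: (Diff_eigen Dd _ hgl).
have := d_eig l; rewrite -comp_lfunA AutG_comp_amull // !comp_lfunA.
by move/(congr1 (fun f => f \o h^-1)%VF); rewrite !lker0_compfK ?AutG_lker0.
Qed.

Lemma left_multiples_closed h :
  [/\ left_multiples (Diff L) h 0,
      forall u v, left_multiples (Diff L) h u -> left_multiples (Diff L) h v ->
        left_multiples (Diff L) h (u + v)
    & forall d u, Diff L d -> left_multiples (Diff L) h u ->
        left_multiples (Diff L) h (d \o u)%VF].
Proof.
have [_ DD _ DM] := Diff_subalgebra; split.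
- by exists 0; rewrite ?comp_lfun0l // -(linear0 (@amull K L)); apply: Diff_amull.
- move=> _ _ [d Dd <-] [e De <-]; exists (d + e); first exact: DD.
  by rewrite comp_lfunDl.
- move=> d _ Dd [e De <-]; exists (d \o e)%VF; first exact: DM.
  by rewrite comp_lfunA.
Qed.

(** A commutator twisted by [g]; it vanishes for all [l] exactly when [f] is [g]-semilinear. *)
Definition twist g l f : 'End(L) := (f \o amull l)%VF - (amull (g l) \o f)%VF.

(** For [h = g] the new coefficient is the ordinary bracket of [d] with [g l], hence of smaller
    order. *)
Lemma twist_comp g h l d : AutG L h ->
  twist g l (d \o h)%VF = (((d \o amull (h l)) - (amull (g l) \o d)) \o h)%VF.
Proof.
move=> Gh; rewrite /twist comp_lfunDl comp_lfunNl -comp_lfunA.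
by rewrite (AutG_comp_amull _ Gh) !comp_lfunA.
Qed.

Lemma twist_left_multiples g h l f : AutG L h ->
  left_multiples (Diff L) h f -> left_multiples (Diff L) h (twist g l f).
Proof.
have [_ _ _ DM] := Diff_subalgebra.
have [_ add comp] := left_multiples_closed h.
move=> Gh [d Dd <-]; rewrite /twist; apply: add.
  rewrite -comp_lfunA AutG_comp_amull // comp_lfunA.
  by exists (d \o amull (h l))%VF => //; apply: DM => //; apply: Diff_amull.
rewrite -comp_lfunNl -linearN; apply: comp; first exact: Diff_amull.
by exists d.
Qed.

(* The twist by g maps each Diff h to itself and lowers the order of the
   coefficient of g. *)
Lemma Diff_Aut_direct : family_direct (AutG L) (left_multiples (Diff L)).
Proof.
elim=> [//|g s IHs] x [/= /andP [g_notin s_uniq] fam].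
have famG h : h \in g :: s -> AutG L h by case/fam.
have sub_gs h : h \in s -> h \in g :: s by rewrite inE orbC => ->.
have Gg : AutG L g by apply: famG; rewrite mem_head.
have Dx h : h \in g :: s -> left_multiples (Diff L) h (x h) by case/fam.
have [d [i _ Dd] xg] := Dx g (mem_head _ _).
(* Order strictly below [n], where [n = 0] means zero. In that base case the term at [g] disappears
   and the induction on the list applies. *)
pose Diff_lt n e := if n is j.+1 then Diff_order j e else e = 0.
have {}Dd : Diff_lt i.+1 d by [].
clear fam; elim: {i}i.+1 x Dx d Dd xg => [|i IHi] x Dx d Dd xg sum_x.
  have xg0 : x g = 0 by rewrite -xg Dd comp_lfun0l.
  move=> h; rewrite inE => /predU1P [-> //|sh]; apply: IHs h sh.
    by split=> // h sh; split; [apply: famG | apply: Dx]; apply: sub_gs.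
  by rewrite big_cons xg0 add0r in sum_x.
(* The twisted terms again sum to 0 and their coefficient at [g] has smaller order, so the induction
   hypothesis kills all of them. *)
have T0 l h : h \in g :: s -> twist g l (x h) = 0.
  pose y h := twist g l (x h).
  have Dy h' : h' \in g :: s -> left_multiples (Diff L) h' (y h').
    by move=> sh; apply: twist_left_multiples; [apply: famG | apply: Dx].
  have yg : (((d \o amull (g l)) - (amull (g l) \o d)) \o g)%VF = y g.
    by rewrite /y -xg twist_comp.
  apply: (IHi y Dy _ _ yg).
    case: i {IHi} Dd => [|i]; last exact.
    by case=> m _ <-; rewrite /= !comp_amull mulrC subrr.
  rewrite sumrB -comp_lfun_suml -comp_lfun_sumr sum_x.
  by rewrite comp_lfun0l comp_lfun0r subrr.
(* All twists being 0, each [x h] with [h] in [s] is [g]-semilinear while [h != g], so it is 0; the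
   sum then leaves [x g = 0]. *)
have xs0 h : h \in s -> x h = 0.
  move=> sh; have gsh := sub_gs h sh; have [e De xh] := Dx h gsh.
  rewrite -xh (Diff_Aut_eigen Gg (famG h gsh) De) ?comp_lfun0l //.
    by apply: contraNneq g_notin => <-.
  by move=> l; apply/eqP; rewrite -subr_eq0 xh; apply/eqP/T0.
move=> h; rewrite inE => /predU1P [->|]; last exact: xs0.
by rewrite big_cons big_seq big1 ?addr0 in sum_x.
Qed.

(** * The skew group algebra as the generated subalgebra *)

Lemma Diff_Aut_sum (I : Type) (r : seq I) (P : pred I) (F : I -> 'End(L)) :
  (forall i, P i -> Diff_Aut L (F i)) -> Diff_Aut L (\sum_(i <- r | P i) F i).
Proof.
move=> DF; apply: big_ind => //; first by exists [::], id; rewrite big_nil.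
move=> _ _ [s [x [[s_uniq sP] ->]]] [t [y [[t_uniq tP] ->]]].
(* Only distinct automorphisms may be listed, so both families are extended by 0 to the merged
   support and added there. *)
pose z g := (if g \in s then x g else 0) + (if g \in t then y g else 0).
exists (undup (s ++ t)), z; split.
  split=> [|g]; first exact: undup_uniq.
  have [zero add _] := left_multiples_closed g.
  rewrite mem_undup mem_cat => stg; split.
    by case/orP: stg => [/sP|/tP] [].
  by apply: add; [case: ifP => // /sP [] | case: ifP => // /tP []].
have restrict u (w : 'End(L) -> 'End(L)) : uniq u -> {subset u <= s ++ t} ->
    \sum_(g <- u) w g = \sum_(g <- undup (s ++ t)) (if g \in u then w g else 0).
  move=> u_uniq sub_u; rewrite -big_mkcond /= -[RHS]big_filter.
  apply/perm_big/uniq_perm => //; first by rewrite filter_uniq ?undup_uniq.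
  move=> g; rewrite mem_filter mem_undup.
  by apply/idP/andP => [ug|[] //]; split=> //; apply: sub_u.
by rewrite big_split /=; congr (_ + _); apply: restrict => // g;
  rewrite mem_cat => ->; rewrite ?orbT.
Qed.

Lemma Diff_Aut_comp_mem d g : Diff L d -> AutG L g -> Diff_Aut L (d \o g)%VF.
Proof.
move=> Dd Gg; exists [:: g], (fun=> (d \o g)%VF); rewrite big_seq1; split=> //.
by split=> // h; rewrite inE => /eqP ->; split=> //; exists d.
Qed.

Lemma skew_mul d e g h : AutG L g ->
  ((d \o g) \o (e \o h) = (d \o (g \o e \o g^-1)) \o (g \o h))%VF.
Proof.
by move=> Gg; rewrite !comp_lfunA lker0_compfVK ?AutG_lker0.
Qed.

(** Choice gathers the coefficients into one function, giving the form in which products and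
    commutation are computed termwise. *)
Lemma Diff_AutP f : Diff_Aut L f ->
  exists (s : seq 'End(L)) (d : 'End(L) -> 'End(L)),
    (forall g, g \in s -> AutG L g /\ Diff L (d g)) /\
    f = \sum_(g <- s) (d g \o g)%VF.
Proof.
move=> [s [x [[_ sP] ->]]].
have dP g : exists d, g \in s -> Diff L d /\ (d \o g)%VF = x g.
  case: (boolP (g \in s)) => [/sP [_ [d Dd dg]]|_]; last by exists 0.
  by exists d.
have [d {}dP] := choice dP; exists s, d; split=> [g sg|].
  by split; [case: (sP g sg) | case: (dP g sg)].
by apply: eq_big_seq => g /dP [].
Qed.

Lemma Diff_sub_Diff_Aut : Diff L `<=` Diff_Aut L.
Proof.
by move=> d Dd; rewrite -[d]comp_lfun1r; apply: Diff_Aut_comp_mem AutG_id.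
Qed.

Lemma Diff_Aut_subalgebra : is_subalgebra (Diff_Aut L).
Proof.
have [D1 _ _ DM] := Diff_subalgebra.
have DAM f h : Diff_Aut L f -> Diff_Aut L h -> Diff_Aut L (f \o h)%VF.
  move=> /Diff_AutP [s [d [sP ->]]] /Diff_AutP [t [e [tP ->]]].
  rewrite comp_lfun_suml big_seq; apply: Diff_Aut_sum => g /sP [Gg Dd].
  rewrite comp_lfun_sumr big_seq; apply: Diff_Aut_sum => h' /tP [Gh De].
  rewrite skew_mul //; apply: Diff_Aut_comp_mem; last exact: AutG_comp.
  by apply: DM => //; apply: AutG_conj_Diff.
split=> //; first exact: Diff_sub_Diff_Aut.
- move=> f h Df Dh; pose F b := if b then f else h.
  have -> : f + h = \sum_(b <- [:: true; false]) F b.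
    by rewrite big_cons big_seq1.
  by apply: Diff_Aut_sum => -[].
- move=> a f Df; rewrite -[f]comp_lfun1l comp_lfunZl; apply: DAM => //.
  by apply: Diff_sub_Diff_Aut; have [_ _ DZ _] := Diff_subalgebra; apply: DZ.
Qed.

Lemma generated_Diff_Aut : generated_subalgebra (AutG L `|` Diff L) = Diff_Aut L.
Proof.
apply/seteqP; split.
  apply: smallest_sub; first exact: Diff_Aut_subalgebra.
  have [D1 _ _ _] := Diff_subalgebra.
  move=> f [Gf|Df]; first by rewrite -[f]comp_lfun1l; apply: Diff_Aut_comp_mem.
  by rewrite -[f]comp_lfun1r; apply: Diff_Aut_comp_mem AutG_id.
move=> f /Diff_AutP [s [d [sP ->]]] A [[A1 AD AZ AM] subA].
rewrite big_seq; apply: (big_ind A) => //; first by rewrite -(scale0r \1%VF); apply: AZ.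
by move=> g /sP [Gg Dd]; apply: AM; apply: subA; [right | left].
Qed.

(** * Centralizer, base field and double centralizer *)

Lemma centralizer_Diff_Aut :
  centralizer (Diff_Aut L) = [set amull l | l in L_fix_dif L].
Proof.
have [D1 _ _ _] := Diff_subalgebra.
apply/seteqP; split=> [f f_cent|_ [l [l_fix l_dif] <-] f].
  (* Commuting with the multiplications by L makes [f] L-linear. Commutation with [g], evaluated at
     1, then says that [g] fixes [f 1]. *)
  have fE : f = amull (f 1).
    apply/lfunP => x; have := f_cent _ (Diff_sub_Diff_Aut (Diff_amull x)).
    by move/lfunP/(_ 1); rewrite !comp_lfunE !amullE mulr1 mulrC.
  exists (f 1) => //; split=> [g Gg|d Dd]; last by rewrite -fE; apply/f_cent/Diff_sub_Diff_Aut.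
  have := f_cent g; rewrite -[X in Diff_Aut L X]comp_lfun1l.
  move/(_ (Diff_Aut_comp_mem D1 Gg))/lfunP/(_ 1).
  by rewrite !comp_lfunE AutG1.
move/Diff_AutP => [s [d [sP ->]]].
rewrite comp_lfun_sumr comp_lfun_suml; apply: eq_big_seq => g /sP [Gg Dd].
by rewrite comp_lfunA l_dif // -!comp_lfunA AutG_comp_amull // l_fix.
Qed.

(** Membership is restated as commutation with [Diff_Aut L], so the closure properties are those of
    a centralizer. *)
Lemma L_fix_dif_subfield : exists M : {subfield L}, [set` M] = L_fix_dif L.
Proof.
have cent l : L_fix_dif L l <-> centralizer (Diff_Aut L) (amull l).
  rewrite centralizer_Diff_Aut; split=> [?|[m ? /amull_inj <-] //].
  by exists l.
have [||a u /cent Cu|M ME] := @set_of_vspace _ _ (L_fix_dif L).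
- by apply/cent => f _; rewrite linear0 comp_lfun0l comp_lfun0r.
- move=> u v /cent Cu /cent Cv; apply/cent => f Df.
  by rewrite linearD comp_lfunDl comp_lfunDr Cu // Cv.
- by apply/cent => f Df; rewrite linearZ -comp_lfunZl -comp_lfunZr Cu.
have MP l : l \in M <-> centralizer (Diff_Aut L) (amull l) by rewrite -cent -ME.
have M1 : 1 \in M by apply/MP => f _; rewrite amull1 comp_lfun1l comp_lfun1r.
have M_aspace : is_aspace M.
  rewrite /is_aspace has_algid1 //=; apply/prodvP => u v /MP Cu /MP Cv.
  by apply/MP => f Df; rewrite -comp_amull -comp_lfunA Cv // !comp_lfunA Cu.
by exists (ASpace M_aspace).
Qed.

(** A map commuting with the centralizing scalars is, by Jacobson-Bourbaki, an L-combination of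
    members of [Diff_Aut L], which contains L. *)
Lemma Diff_Aut_bicommutant :
  centralizer [set amull l | l in L_fix_dif L] = Diff_Aut L.
Proof.
have Asub := Diff_Aut_subalgebra; have [_ _ _ AM] := Asub.
have AL l : Diff_Aut L (amull l) by apply/Diff_sub_Diff_Aut/Diff_amull.
rewrite -centralizer_Diff_Aut; apply/seteqP; split=> [f f_cent|f Df h]; last first.
  by move=> /(_ f Df) ->.
have [s [sA _ s_gen]] := Jacobson_Bourbaki Asub AL.
rewrite [f]s_gen => [|m Cm]; last exact: f_cent.
by rewrite big_seq; apply: is_subalgebra_sum => // q /sA Aq; apply: AM.
Qed.

End SkewGroupAlgebra.

Theorem theorem5p15 (K : fieldType) (p : nat) (charK : p \in [pchar K])
    (L : fieldExtType K) :
  [/\ generated_subalgebra (AutG L `|` Diff L) = Diff_Aut L,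
      is_subalgebra (Diff L),
      family_direct (AutG L) (left_multiples (Diff L)),
      forall g, AutG L g -> free_generator (Diff L) g
    & forall d d' g g', Diff L d -> Diff L d' -> AutG L g -> AutG L g' ->
        [/\ Diff L (g \o d' \o g^-1)%VF,
            AutG L (g \o g')%VF
          & ((d \o g) \o (d' \o g') =
             (d \o (g \o d' \o g^-1)) \o (g \o g'))%VF]]
  /\
  (exists M : {subfield L},
     [/\ [set` M] = L_fix_dif L,
         Diff_Aut L = End_over M
       & central_simple_fin_dim M (Diff_Aut L)])
  /\
  (centralizer (Diff_Aut L) = [set amull l | l in L_fix_dif L] /\
   centralizer [set amull l | l in L_fix_dif L] = Diff_Aut L).
Proof.
have Diff_Aut_amull l : Diff_Aut L (amull l).
  exact/Diff_sub_Diff_Aut/Diff_amull.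
split; [split|split; last by split;
  [apply: centralizer_Diff_Aut | apply: Diff_Aut_bicommutant]].
- exact: generated_Diff_Aut.
- exact: Diff_subalgebra.
- exact: Diff_Aut_direct.
- move=> g Gg d _ /(congr1 (fun f => f \o g^-1)%VF).
  by rewrite comp_lfun0l lker0_compfK ?AutG_lker0.
- move=> d d' g g' _ Dd' Gg Gg'; split; [exact: AutG_conj_Diff | exact: AutG_comp|].
  exact: skew_mul.
have [M ME] := L_fix_dif_subfield L; exists M; split=> //.
  (* Being [M]-linear means commuting with the multiplications by [M], so the double centralizer is
     [End_over M]. *)
  rewrite -Diff_Aut_bicommutant -ME; apply/seteqP; split=> f f_lin.
    move=> m x Mm; have := f_lin (amull m) (ex_intro2 _ _ m Mm erefl).
    by move/lfunP/(_ x); rewrite !comp_lfunE !amullE.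
  by move=> _ [m Mm <-]; apply/lfunP => x; rewrite !comp_lfunE !amullE f_lin.
split.
- exact: Diff_Aut_subalgebra.
(* The center is the whole centralizer, as the latter consists of multiplications by L and these lie
   in the algebra. *)
- rewrite ME centralizer_Diff_Aut; apply/seteqP; split=> [f [] //|f fM].
  by split=> //; case: fM => l _ <-.
- by apply: Jacobson_Bourbaki_simple => //; apply: Diff_Aut_subalgebra.
- by apply: finite_dim_over_subalgebra => //; apply: Diff_Aut_subalgebra.
Qed.
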